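(* Let $n$ be a positive integer and suppose $n$ can be decomposed as $n=n_1+n_2+\cdots+n_k$. Then the local energy of the complete graph $K_n$ is $e(K_n)=e(K_{n_1}\cup K_{n_2}\cup\cdots\cup K_{n_k})$, where $\cup$ denotes disjoint union.
   Context: For a finite simple undirected graph $G$ with vertices $v_1,\dots,v_n$, the adjacency matrix $A(G)$ has $(i,j)$ entry $1$ if $v_i,v_j$ are adjacent and $0$ otherwise. The energy $\mathscr{E}(G)$ is the sum of the absolute values of the eigenvalues of $A(G)$ (counted with multiplicity); the graph with no vertices has energy $0$. For a vertex $v$ of $G$, let $G^{v}$ be the graph obtained from $G$ by deleting $v$. The local energy of $G$ at $v$ is $\mathscr{E}_G(v)=\mathscr{E}(G)-\mathscr{E}(G^{v})$, and the local energy of $G$ is $e(G)=\sum_{v\in V(G)}\mathscr{E}_G(v)$. For a positive integer $m$, $K_m$ denotes the complete graph on $m$ vertices.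
   Formalization: For n > 1 the parts n_i are assumed different from 1, since the claim fails otherwise: e(K_2) = 4 but e(K_1 ∪ K_1) = 0; equality for n > 1 holds exactly when no part equals 1. *)

(* Defs.v *)
From HB Require Import structures.
From mathcomp Require Import all_boot all_order all_algebra.
Set Implicit Arguments. Unset Strict Implicit. Unset Printing Implicit Defensive.
Import Order.TTheory GRing.Theory Num.Theory.
Local Open Scope ring_scope.

Record sgraph := SGraph {
  svertex :> finType;
  adj : rel svertex;
  adj_sym : symmetric adj;
  adj_irr : irreflexive adj }.

Definition del_adj (G : sgraph) (v : G) : rel {x : G | x != v} :=
  fun x y => adj (val x) (val y).

Lemma del_adj_sym (G : sgraph) (v : G) : symmetric (@del_adj G v).
Proof. by move=> x y; apply: adj_sym. Qed.

Lemma del_adj_irr (G : sgraph) (v : G) : irreflexive (@del_adj G v).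
Proof. by move=> x; apply: adj_irr. Qed.

Definition del_vertex (G : sgraph) (v : G) : sgraph :=
  SGraph (@del_adj_sym G v) (@del_adj_irr G v).

Definition complete_adj (m : nat) : rel 'I_m := fun x y => x != y.

Lemma complete_adj_sym m : symmetric (@complete_adj m).
Proof. by move=> x y; rewrite /complete_adj eq_sym. Qed.

Lemma complete_adj_irr m : irreflexive (@complete_adj m).
Proof. by move=> x; rewrite /complete_adj eqxx. Qed.

Definition complete (m : nat) : sgraph :=
  SGraph (@complete_adj_sym m) (@complete_adj_irr m).

(* [tagged_as u w] is [tagged w] transported to the type of [tagged u]; it is
   meaningful because the tags are first tested for equality. *)
Definition union_adj (I : finType) (H : I -> sgraph) : rel {i : I & H i} :=
  fun u w => (tag u == tag w) && adj (tagged u) (tagged_as u w).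

Lemma union_adj_sym (I : finType) (H : I -> sgraph) : symmetric (@union_adj I H).
Proof.
case=> i x [j y]; rewrite /union_adj /=; case: (eqVneq i j) => [eij|//] /=.
by case: j / eij y => y; rewrite !tagged_asE adj_sym.
Qed.

Lemma union_adj_irr (I : finType) (H : I -> sgraph) : irreflexive (@union_adj I H).
Proof. by case=> i x; rewrite /union_adj /= tagged_asE adj_irr andbF. Qed.

Definition disjoint_union (I : finType) (H : I -> sgraph) : sgraph :=
  SGraph (@union_adj_sym I H) (@union_adj_irr I H).

(* The field [C] plays the role of the complex numbers. *)
Definition adjacency (C : numClosedFieldType) (G : sgraph) : 'M[C]_#|G| :=
  \matrix_(i, j) (adj (enum_val i) (enum_val j))%:R.

(* The eigenvalues listed with multiplicity: [closed_field_poly_normal p]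
   provides a sequence [r] with [p = lead_coef p *: \prod_(z <- r) ('X - z%:P)],
   which is unique up to permutation. *)
Definition spectrum (C : numClosedFieldType) (n : nat) (A : 'M[C]_n) : seq C :=
  sval (closed_field_poly_normal (char_poly A)).

Definition energy (C : numClosedFieldType) (G : sgraph) : C :=
  \sum_(z <- spectrum (adjacency C G)) `|z|.

Definition local_energy_at (C : numClosedFieldType) (G : sgraph) (v : G) : C :=
  energy C G - energy C (del_vertex v).

Definition local_energy (C : numClosedFieldType) (G : sgraph) : C :=
  \sum_(v : G) local_energy_at C v.

(* Main.v *)
Require Import Defs.
From HB Require Import structures.
From mathcomp Require Import all_boot all_order all_algebra.
From mathcomp Require Import ring.
Set Implicit Arguments. Unset Strict Implicit. Unset Printing Implicit Defensive.
Import Order.TTheory GRing.Theory Num.Theory.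
Local Open Scope ring_scope.

(** Complete graphs, their disjoint unions, and every graph obtained from these
by deleting a vertex are cluster graphs: for some labelling [f] of the vertices,
two distinct vertices are adjacent exactly when they have the same label.  This
class is closed under vertex deletion, so one computation of the energy serves
both sides of the identity.

Let [B] be the incidence matrix between vertices and labels.  The adjacency
matrix is then [B B^T - 1], while [B^T B] is diagonal with the class sizes
[s_i] as entries.  Since [B B^T] and [B^T B] have the same eigenvalues up to
zeros ([det_scalar_sub_mulmxC]), the spectrum of the graph is the list of the
[s_i - 1], up to copies of [-1] ([perm_spectrum_cluster]), and the energy is
[#|G| - #|I| + \sum_i `|s_i - 1|] ([energy_cluster]).  Deleting [v] lowers the
first term and one class size by 1, so the local energy at [v] is 2, or 0 if
[v] is isolated ([local_energy_at_cluster]).  Without isolated vertices, the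
local energy of a cluster graph is therefore twice its number of vertices,
whatever the sizes of the cliques.  This settles [n > 1], where no part has
size 1; for [n = 1] both graphs are a single isolated vertex. *)

(** Both sides are the determinant of the block matrix with blocks [x], [B],
[B'], [1], multiplied by [x ^+ n]: clearing the lower left block on the right
gives the first side, clearing it on the left gives the second. *)
Lemma det_scalar_sub_mulmxC (R : comNzRingType) m n
    (B : 'M[R]_(m, n)) (B' : 'M[R]_(n, m)) (x : R) :
  x ^+ n * \det (x%:M - B *m B') = x ^+ m * \det (x%:M - B' *m B).
Proof.
pose M := block_mx x%:M B B' 1%:M.
have -> : \det (x%:M - B *m B') = \det M.
  have := det_mulmx M (block_mx 1%:M 0 (- B') 1%:M).
  rewrite det_lblock !det_scalar !expr1n !mulr1 mulmx_block.
  rewrite !mulmx1 !mulmx0 !add0r mul1mx.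
  by rewrite subrr mulmxN det_ublock det1 mulr1.
have := det_mulmx (block_mx 1%:M 0 (- B') x%:M) M.
rewrite det_lblock det1 mul1r det_scalar mulmx_block !mul1mx !mul0mx !addr0.
rewrite mulmx1 !mulNmx mul_mx_scalar mul_scalar_mx addNr => <-.
by rewrite det_ublock det_scalar addrC.
Qed.

Definition cluster (G : sgraph) (I : finType) (f : G -> I) : Prop :=
  forall x y : G, adj x y = (x != y) && (f x == f y).

Definition class_size (T I : finType) (f : T -> I) (i : I) : nat :=
  #|[pred x | f x == i]|.

Lemma cluster_complete n : cluster (fun _ : complete n => tt).
Proof. by move=> x y; rewrite eqxx andbT. Qed.

Lemma cluster_disjoint_union (I : finType) (m : I -> nat) :
  cluster (fun u : disjoint_union (fun i => complete (m i)) => tag u).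
Proof.
case=> i x [j y] /=; rewrite /union_adj /=; case: (eqVneq i j) => [eij|//].
  by case: j / eij y => y; rewrite tagged_asE andbT -/(Tagged _ y) eq_Tagged.
by rewrite andbF.
Qed.

Lemma cluster_del_vertex (G : sgraph) (I : finType) (f : G -> I) (v : G) :
  cluster f -> cluster (fun x : del_vertex v => f (val x)).
Proof. by move=> fP x y; rewrite /= /del_adj fP. Qed.

Lemma card_del_vertex (G : sgraph) (v : G) : #|G| = #|del_vertex v|.+1.
Proof.
rewrite card_sig (cardD1 v) inE add1n; congr _.+1.
by apply: eq_card => x; rewrite !inE andbT.
Qed.

Lemma class_size_del_vertex (G : sgraph) (I : finType) (f : G -> I) (v : G) i :
  class_size f i
  = ((f v == i) + class_size (fun x : del_vertex v => f (val x)) i)%N.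
Proof.
rewrite /class_size (cardD1 v) inE; congr (_ + _)%N.
rewrite -(card_image val_inj); apply: eq_card => x.
rewrite !inE; apply/andP/imageP => [[ne_xv fx]|[[y ne_yv] fy ->] //].
by exists (Sub x ne_xv).
Qed.

Section Energy.
Variable C : numClosedFieldType.

Lemma char_poly_spectrum n (A : 'M[C]_n) :
  char_poly A = \prod_(z <- spectrum A) ('X - z%:P).
Proof.
rewrite /spectrum; case: closed_field_poly_normal => r /= {1}->.
by rewrite (monicP (char_poly_monic A)) scale1r.
Qed.

(** The two lists of copies of [-1] are the zeros by which the spectra of
[B B^T] and [B^T B] differ, shifted by the identity matrix. *)
Lemma perm_spectrum_cluster (G : sgraph) (I : finType) (f : G -> I) :
  cluster f ->
  perm_eq (nseq #|I| (-1) ++ spectrum (adjacency C G))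
          (nseq #|G| (-1) ++ [seq (class_size f i)%:R - 1 | i <- enum I]).
Proof.
move=> fP; apply: prod_XsubC_eq; rewrite !big_cat -char_poly_spectrum /=.
rewrite !big_nseq !iter_mulr_1 polyCN opprK.
pose B : 'M[{poly C}]_(#|G|, #|I|) :=
  \matrix_(a, b) (f (enum_val a) == enum_val b)%:R.
(* Evaluating at ['X + 1] absorbs the identity subtracted from [B B^T]. *)
have -> : char_poly (adjacency C G) = \det (('X + 1%:P)%:M - B *m B^T).
  congr (\det _); apply/matrixP=> a b; rewrite !mxE.
  under eq_bigr do rewrite !mxE -natrM mulnb.
  rewrite (bigD1 (enum_rank (f (enum_val a)))) //= enum_rankK eqxx /=.
  rewrite big1 ?addr0 => [|c]; last first.
    by rewrite -(inj_eq enum_val_inj) enum_rankK eq_sym => /negPf -> //.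
  rewrite fP (inj_eq enum_val_inj) [f (enum_val b) == _]eq_sym.
  case: (eqVneq a b) => [->|_] /=.
    by rewrite eqxx !mulr1n polyC0 subr0 polyC1 addrK.
  by rewrite !mulr0n polyC_natr.
rewrite det_scalar_sub_mulmxC; congr (_ * _).
have -> : B^T *m B = diag_mx (\row_b (class_size f (enum_val b))%:R).
  apply/matrixP=> b c; rewrite !mxE.
  under eq_bigr do rewrite !mxE -natrM mulnb.
  rewrite -natr_sum; case: (eqVneq b c) => [->|neq_bc].
    rewrite mulr1n; congr _%:R; rewrite /class_size -[RHS]sum1_card.
    rewrite [RHS](reindex _ (onW_bij _ (enum_val_bij G))) [RHS]big_mkcond /=.
    by apply: eq_bigr => a _; rewrite andbb inE; case: eqP.
  rewrite mulr0n big1 // => a _; case: eqP => //= ->.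
  by rewrite (inj_eq enum_val_inj) (negPf neq_bc).
rewrite -diag_const_mx -linearB det_diag big_map big_enum /= [RHS]big_enum_val.
apply: eq_bigr => b _; rewrite !mxE.
by rewrite polyCB polyC_natr opprB addrA addrAC.
Qed.

Lemma energy_cluster (G : sgraph) (I : finType) (f : G -> I) :
  cluster f ->
  energy C G
  = #|G|%:R - #|I|%:R + \sum_i `|(class_size f i)%:R - 1|.
Proof.
move=> /perm_spectrum_cluster/(perm_big _) eqE.
have := eqE _ +%R 0 xpredT (fun z : C => `|z|).
rewrite !big_cat !big_nseq !iter_addr_0 normrN1 big_map big_enum /= => eqS.
by rewrite addrAC -eqS addrC addKr.
Qed.

(** Only the class of [v] changes size: as [s >= 1], passing from [s] to
[s - 1] changes [`|s - 1|] by 1 downwards, except from [s = 1], when it changes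
by 1 upwards and cancels the contribution of the number of vertices. *)
Lemma local_energy_at_cluster (G : sgraph) (I : finType) (f : G -> I) (v : G) :
  cluster f ->
  local_energy_at C v = if (1 < class_size f (f v))%N then 2 else 0.
Proof.
move=> fP; rewrite /local_energy_at (energy_cluster fP).
rewrite (energy_cluster (cluster_del_vertex (v := v) fP)) (card_del_vertex v).
rewrite (class_size_del_vertex f v (f v)) eqxx.
set c := class_size (fun x : del_vertex v => f (val x)).
pose S : C := \sum_(i | i != f v) `|(c i)%:R - 1|.
have -> : \sum_i `|(class_size f i)%:R - 1| = (c (f v))%:R + S.
  rewrite (bigD1 (f v)) //=; congr (_ + _).
    rewrite (class_size_del_vertex f v) eqxx natrD addrAC subrr add0r.
    by rewrite normr_nat.
  apply: eq_bigr => i ne_i.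
  by rewrite (class_size_del_vertex f v) eq_sym (negPf ne_i).
have -> : \sum_i `|(c i)%:R - 1| = `|(c (f v))%:R - 1| + S.
  by rewrite (bigD1 (f v)).
move: (c (f v)) S #|del_vertex v| => [|s] S N.
  by rewrite sub0r normrN1 -natr1 /=; ring.
have -> : `|s.+1%:R - 1| = s%:R :> C by rewrite -natr1 addrK normr_nat.
by rewrite -!natr1 /=; ring.
Qed.

Lemma local_energy_cluster (G : sgraph) (I : finType) (f : G -> I) (b : bool) :
  cluster f -> (forall v, (1 < class_size f (f v))%N = b) ->
  local_energy C G = (if b then 2 else 0) *+ #|G|.
Proof.
move=> fP sz; rewrite /local_energy.
under eq_bigr => v _ do rewrite (local_energy_at_cluster v fP) sz.
by rewrite sumr_const.
Qed.

End Energy.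

Lemma card_disjoint_union_complete k (m : 'I_k -> nat) :
  #|disjoint_union (fun i => complete (m i))| = (\sum_(i < k) m i)%N.
Proof.
rewrite card_tagged sumnE big_map big_enum /=.
by apply: eq_bigr => i _; rewrite card_ord.
Qed.

Lemma class_size_disjoint_union (I : finType) (m : I -> nat) i :
  (m i <= class_size
     (fun u : disjoint_union (fun i => complete (m i)) => tag u) i)%N.
Proof.
rewrite -[X in (X <= _)%N]card_ord.
rewrite -(card_codom (f := @Tagged I i (fun j => 'I_(m j)))).
  by apply/subset_leq_card/subsetP=> _ /codomP[x ->]; rewrite inE /=.
by move=> x y /eqP; rewrite eq_Tagged => /eqP.
Qed.

Theorem theorem2 (C : numClosedFieldType) (n k : nat) (m : 'I_k -> nat)
    (n_gt0 : (0 < n)%N)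
    (m_gt0 : forall i, (0 < m i)%N)
    (n_eq : n = (\sum_(i < k) m i)%N)
    (m_neq1 : (1 < n)%N -> forall i, m i <> 1%N) :
  local_energy C (complete n)
  = local_energy C (disjoint_union (fun i => complete (m i))).
Proof.
rewrite (local_energy_cluster (b := (1 < n)%N) C (@cluster_complete n)); last first.
  by move=> _; rewrite -[in RHS](card_ord n).
have cardU := card_disjoint_union_complete m.
rewrite (local_energy_cluster (b := (1 < n)%N) C (cluster_disjoint_union (m := m))).
  by rewrite cardU -n_eq card_ord.
move=> u; case: (ltnP 1 n) => [n_gt1|n_le1].
  apply: leq_trans (class_size_disjoint_union m (tag u)).
  by rewrite ltn_neqAle m_gt0 andbT eq_sym; apply/eqP/m_neq1.
apply: negbTE; rewrite -leqNgt; apply: leq_trans n_le1.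
by rewrite n_eq -cardU max_card.
Qed.
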